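(* Each categorical ring satisfying condition (U) (stated in the context) is an Ann-category. That is, if $(\mathcal A,\oplus,\otimes,a^+,c,(0,g,d),a,(1,l,r),\mathcal L,\mathcal R)$ is a categorical ring satisfying (U), then the same data form an Ann-category.
   Context: A symmetric categorical group (also called Pic-category) is a groupoid with a symmetric monoidal structure $(\oplus,a^+,c,(0,g,d))$, where $a^+_{X,Y,Z}:X\oplus(Y\oplus Z)\to(X\oplus Y)\oplus Z$, $c_{X,Y}:X\oplus Y\to Y\oplus X$, $g_X:0\oplus X\to X$, $d_X:X\oplus 0\to X$, in which every object is invertible up to isomorphism for $\oplus$ (it is not required that $c_{X,X}=\mathrm{id}$). In it, $v_{U,V,Z,T}:(U\oplus V)\oplus(Z\oplus T)\to(U\oplus Z)\oplus(V\oplus T)$ denotes the canonical natural isomorphism built from $a^+$, $c$ and identities which exchanges $V$ and $Z$. We write $AB$ for $A\otimes B$. Common data. Both notions below consist of a symmetric categorical group $(\mathcal A,\oplus,a^+,c,(0,g,d))$, a bifunctor $\otimes:\mathcal A\times\mathcal A\to\mathcal A$, an object $1$, natural isomorphisms $a_{A,B,C}:A(BC)\to(AB)C$ (for a categorical ring the associativity law is given in the direction $(AB)C\to A(BC)$; $a$ then denotes its inverse), $l_X:1X\to X$, $r_X:X1\to X$ such that $(\mathcal A,\otimes,a,(1,l,r))$ is a monoidal category, and natural isomorphisms $\mathcal L_{A,X,Y}:A(X\oplus Y)\to AX\oplus AY$, $\mathcal R_{X,Y,A}:(X\oplus Y)A\to XA\oplus YA$. Common axioms. For all objects: (1.1)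 $\mathcal L_{AB,X,Y}\circ a_{A,B,X\oplus Y}=(a_{A,B,X}\oplus a_{A,B,Y})\circ\mathcal L_{A,BX,BY}\circ(\mathrm{id}_A\otimes\mathcal L_{B,X,Y})$; (1.1') $\mathcal R_{XB,YB,A}\circ(\mathcal R_{X,Y,B}\otimes\mathrm{id}_A)\circ a_{X\oplus Y,B,A}=(a_{X,B,A}\oplus a_{Y,B,A})\circ\mathcal R_{X,Y,BA}$; (1.2) $\mathcal R_{AX,AY,B}\circ(\mathcal L_{A,X,Y}\otimes\mathrm{id}_B)\circ a_{A,X\oplus Y,B}=(a_{A,X,B}\oplus a_{A,Y,B})\circ\mathcal L_{A,XB,YB}\circ(\mathrm{id}_A\otimes\mathcal R_{X,Y,B})$; (1.3) $v_{AX,BX,AY,BY}\circ(\mathcal R_{A,B,X}\oplus\mathcal R_{A,B,Y})\circ\mathcal L_{A\oplus B,X,Y}=(\mathcal L_{A,X,Y}\oplus\mathcal L_{B,X,Y})\circ\mathcal R_{A,B,X\oplus Y}$; (1.4) $(l_X\oplus l_Y)\circ\mathcal L_{1,X,Y}=l_{X\oplus Y}$; (1.4') $(r_X\oplus r_Y)\circ\mathcal R_{X,Y,1}=r_{X\oplus Y}$. An Ann-category is such data satisfying the common axioms and (Ann-1): for all objects, $$a^+_{AX,AY,AZ}\circ(\mathrm{id}\oplus\mathcal L_{A,Y,Z})\circ\mathcal L_{A,X,Y\oplus Z}=(\mathcal L_{A,X,Y}\oplus\mathrm{id})\circ\mathcal L_{A,X\oplus Y,Z}\circ(\mathrm{id}_A\otimes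 a^+_{X,Y,Z}),$$ $$c_{AX,AY}\circ\mathcal L_{A,X,Y}=\mathcal L_{A,Y,X}\circ(\mathrm{id}_A\otimes c_{X,Y}),$$ $$a^+_{XA,YA,ZA}\circ(\mathrm{id}\oplus\mathcal R_{Y,Z,A})\circ\mathcal R_{X,Y\oplus Z,A}=(\mathcal R_{X,Y,A}\oplus\mathrm{id})\circ\mathcal R_{X\oplus Y,Z,A}\circ(a^+_{X,Y,Z}\otimes\mathrm{id}_A),$$ $$c_{XA,YA}\circ\mathcal R_{X,Y,A}=\mathcal R_{Y,X,A}\circ(c_{X,Y}\otimes\mathrm{id}_A).$$ A categorical ring is such data satisfying the common axioms and, for all objects $R,X,Y,Z,T,S$: (3.1) $v_{RX,RY,RZ,RT}\circ(\mathcal L_{R,X,Y}\oplus\mathcal L_{R,Z,T})\circ\mathcal L_{R,X\oplus Y,Z\oplus T}=(\mathcal L_{R,X,Z}\oplus\mathcal L_{R,Y,T})\circ\mathcal L_{R,X\oplus Z,Y\oplus T}\circ(\mathrm{id}_R\otimes v_{X,Y,Z,T})$; (3.1') $v_{XS,YS,ZS,TS}\circ(\mathcal R_{X,Y,S}\oplus\mathcal R_{Z,T,S})\circ\mathcal R_{X\oplus Y,Z\oplus T,S}=(\mathcal R_{X,Z,S}\oplus\mathcal R_{Y,T,S})\circ\mathcal R_{X\oplus Z,Y\oplus T,S}\circ(v_{X,Y,Z,T}\otimes\mathrm{id}_S)$. Condition (U): for each object $A$ there exist isomorphisms $\widehat L^A:A0\to0$ and $\widehat R^A:0A\to0$ such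 that for all objects $X$ $$g_{AX}\circ(\widehat{L}^A\oplus \mathrm{id}_{AX})\circ \mathcal{L}_{A,0,X}=\mathrm{id}_A\otimes g_X,\qquad d_{AX}\circ(\mathrm{id}_{AX}\oplus\widehat{L}^A)\circ \mathcal{L}_{A,X,0}=\mathrm{id}_A\otimes d_X,$$ $$g_{XA}\circ(\widehat{R}^A\oplus \mathrm{id}_{XA})\circ \mathcal{R}_{0,X,A}=g_X\otimes \mathrm{id}_A,\qquad d_{XA}\circ(\mathrm{id}_{XA}\oplus\widehat{R}^A)\circ \mathcal{R}_{X,0,A}=d_X\otimes \mathrm{id}_A.$$ *)

(* Defs.v *)
(** Groupoids, with morphisms compared by Leibniz equality.  Inversion is an
    operation (inverses being unique, it is no extra structure) because the
    exchange isomorphism [exch] below uses inverses of associators.  As all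
    morphisms are invertible, a natural isomorphism between functors to a
    groupoid is just a natural transformation. *)

Declare Scope cobj_scope.
Declare Scope cmor_scope.
Delimit Scope cobj_scope with cobj.
Delimit Scope cmor_scope with cmor.

Record groupoid : Type := Groupoid {
  obj :> Type;
  hom : obj -> obj -> Type;
  idm : forall X, hom X X;
  comp : forall X Y Z, hom Y Z -> hom X Y -> hom X Z;
  inv : forall X Y, hom X Y -> hom Y X;
  comp_assoc : forall X Y Z T (h : hom Z T) (g : hom Y Z) (f : hom X Y),
    comp _ _ _ h (comp _ _ _ g f) = comp _ _ _ (comp _ _ _ h g) f;
  comp_idl : forall X Y (f : hom X Y), comp _ _ _ (idm Y) f = f;
  comp_idr : forall X Y (f : hom X Y), comp _ _ _ f (idm X) = f;
  comp_invl : forall X Y (f : hom X Y), comp _ _ _ (inv _ _ f) f = idm X;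
  comp_invr : forall X Y (f : hom X Y), comp _ _ _ f (inv _ _ f) = idm Y
}.

Bind Scope cobj_scope with obj.
Bind Scope cmor_scope with hom.
Arguments hom {g0} X%_cobj Y%_cobj : rename.
Arguments idm {g0} X%_cobj : rename.
Arguments comp {g0} {X Y Z} g%_cmor f%_cmor : rename.
Arguments inv {g0} {X Y} f%_cmor : rename.

Notation "g ∘ f" := (comp g f) (at level 40, left associativity) : cmor_scope.
Open Scope cmor_scope.

Record bifunctor (A : groupoid) : Type := Bifunctor {
  bi_obj :> A -> A -> A;
  bi_mor : forall X X' Y Y' : A,
    hom X X' -> hom Y Y' -> hom (bi_obj X Y) (bi_obj X' Y');
  bi_mor_id : forall X Y : A,
    bi_mor _ _ _ _ (idm X) (idm Y) = idm (bi_obj X Y);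
  bi_mor_comp : forall (X X' X'' Y Y' Y'' : A) (f' : hom X' X'') (f : hom X X')
      (g' : hom Y' Y'') (g : hom Y Y'),
    bi_mor _ _ _ _ (f' ∘ f) (g' ∘ g)
    = bi_mor _ _ _ _ f' g' ∘ bi_mor _ _ _ _ f g
}.
Arguments bi_mor {A} F {X X' Y Y'} f%_cmor g%_cmor : rename.

(** The associator goes from X(YZ) to (XY)Z, for both ⊕ and ⊗. *)
Record monoidal {A : groupoid} (F : bifunctor A) (I : A) : Type := Monoidal {
  assoc : forall X Y Z : A, hom (F X (F Y Z)) (F (F X Y) Z);
  lunit : forall X : A, hom (F I X) X;
  runit : forall X : A, hom (F X I) X;
  assoc_nat : forall (X X' Y Y' Z Z' : A)
      (f : hom X X') (g : hom Y Y') (h : hom Z Z'),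
    assoc X' Y' Z' ∘ bi_mor F f (bi_mor F g h)
    = bi_mor F (bi_mor F f g) h ∘ assoc X Y Z;
  lunit_nat : forall (X X' : A) (f : hom X X'),
    lunit X' ∘ bi_mor F (idm I) f = f ∘ lunit X;
  runit_nat : forall (X X' : A) (f : hom X X'),
    runit X' ∘ bi_mor F f (idm I) = f ∘ runit X;
  pentagon : forall X Y Z T : A,
    assoc (F X Y) Z T ∘ assoc X Y (F Z T)
    = bi_mor F (assoc X Y Z) (idm T) ∘ assoc X (F Y Z) T
      ∘ bi_mor F (idm X) (assoc Y Z T);
  triangle : forall X Y : A,
    bi_mor F (runit X) (idm Y) ∘ assoc X I Y = bi_mor F (idm X) (lunit Y)
}.
Arguments assoc {A F I} m X%_cobj Y%_cobj Z%_cobj : rename.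
Arguments lunit {A F I} m X%_cobj : rename.
Arguments runit {A F I} m X%_cobj : rename.

Record symmetry {A : groupoid} {F : bifunctor A} {I : A} (M : monoidal F I)
  : Type := Symmetry {
  braid : forall X Y : A, hom (F X Y) (F Y X);
  braid_nat : forall (X X' Y Y' : A) (f : hom X X') (g : hom Y Y'),
    braid X' Y' ∘ bi_mor F f g = bi_mor F g f ∘ braid X Y;
  braid_sym : forall X Y : A, braid Y X ∘ braid X Y = idm (F X Y);
  braid_unit : forall X : A, lunit M X ∘ braid X I = runit M X;
  hexagon : forall X Y Z : A,
    assoc M Z X Y ∘ braid (F X Y) Z ∘ assoc M X Y Z
    = bi_mor F (braid X Z) (idm Y) ∘ assoc M X Z Y
      ∘ bi_mor F (idm X) (braid Y Z)
}.
Arguments braid {A F I M} s X%_cobj Y%_cobj : rename.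

Record sym_cat_group : Type := SymCatGroup {
  scg_groupoid :> groupoid;
  scg_sum : bifunctor scg_groupoid;
  scg_zero : scg_groupoid;
  scg_monoidal : monoidal scg_sum scg_zero;
  scg_symmetry : symmetry scg_monoidal;
  scg_invertible : forall X : scg_groupoid, exists Y : scg_groupoid,
    inhabited (hom (scg_sum X Y) scg_zero)
    /\ inhabited (hom (scg_sum Y X) scg_zero)
}.
Arguments scg_zero {s}.

Notation "X ⊕ Y" := (bi_obj _ (scg_sum _) X Y)
  (at level 50, left associativity) : cobj_scope.
Notation "f ⊕ g" := (bi_mor (scg_sum _) f g)
  (at level 50, left associativity) : cmor_scope.
Notation "𝟎" := scg_zero : cobj_scope.

Definition addA {G : sym_cat_group} (X Y Z : G)
  : hom (X ⊕ (Y ⊕ Z)) ((X ⊕ Y) ⊕ Z) := assoc (scg_monoidal G) X Y Z.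
Definition addC {G : sym_cat_group} (X Y : G) : hom (X ⊕ Y) (Y ⊕ X) :=
  braid (scg_symmetry G) X Y.
Definition add0l {G : sym_cat_group} (X : G) : hom (𝟎 ⊕ X) X :=
  lunit (scg_monoidal G) X.
Definition add0r {G : sym_cat_group} (X : G) : hom (X ⊕ 𝟎) X :=
  runit (scg_monoidal G) X.

(** The canonical isomorphism v exchanging V and Z, through
    U ⊕ ((V ⊕ Z) ⊕ T) and U ⊕ ((Z ⊕ V) ⊕ T); by coherence any other composite
    of associators, their inverses and one symmetry of V and Z is equal to it. *)
Definition exch {G : sym_cat_group} (U V Z T : G)
  : hom ((U ⊕ V) ⊕ (Z ⊕ T)) ((U ⊕ Z) ⊕ (V ⊕ T)) :=
  addA U Z (V ⊕ T)
  ∘ (idm U ⊕ inv (addA Z V T))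
  ∘ (idm U ⊕ (addC V Z ⊕ idm T))
  ∘ (idm U ⊕ addA V Z T)
  ∘ inv (addA U V (Z ⊕ T)).

Record left_distributor {A : groupoid} (S T : bifunctor A) : Type :=
  LeftDistributor {
  ldist : forall B X Y : A, hom (T B (S X Y)) (S (T B X) (T B Y));
  ldist_nat : forall (B B' X X' Y Y' : A)
      (b : hom B B') (f : hom X X') (g : hom Y Y'),
    ldist B' X' Y' ∘ bi_mor T b (bi_mor S f g)
    = bi_mor S (bi_mor T b f) (bi_mor T b g) ∘ ldist B X Y
}.
Arguments ldist {A S T} l B%_cobj X%_cobj Y%_cobj : rename.

Record right_distributor {A : groupoid} (S T : bifunctor A) : Type :=
  RightDistributor {
  rdist : forall X Y B : A, hom (T (S X Y) B) (S (T X B) (T Y B));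
  rdist_nat : forall (X X' Y Y' B B' : A)
      (f : hom X X') (g : hom Y Y') (b : hom B B'),
    rdist X' Y' B' ∘ bi_mor T (bi_mor S f g) b
    = bi_mor S (bi_mor T f b) (bi_mor T g b) ∘ rdist X Y B
}.
Arguments rdist {A S T} r X%_cobj Y%_cobj B%_cobj : rename.

(** The data shared by Ann-categories and categorical rings. *)
Record ring_data : Type := RingData {
  rd_add :> sym_cat_group;
  rd_tensor : bifunctor rd_add;
  rd_one : rd_add;
  rd_monoidal : monoidal rd_tensor rd_one;
  rd_ldist : left_distributor (scg_sum rd_add) rd_tensor;
  rd_rdist : right_distributor (scg_sum rd_add) rd_tensor
}.
Arguments rd_one {r}.

Notation "X ⊗ Y" := (bi_obj _ (rd_tensor _) X Y)
  (at level 40, left associativity) : cobj_scope.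
Notation "f ⊗ g" := (bi_mor (rd_tensor _) f g)
  (at level 40, left associativity) : cmor_scope.
Notation "𝟏" := rd_one : cobj_scope.

Definition mulA {D : ring_data} (X Y Z : D)
  : hom (X ⊗ (Y ⊗ Z)) ((X ⊗ Y) ⊗ Z) := assoc (rd_monoidal D) X Y Z.
Definition mul1l {D : ring_data} (X : D) : hom (𝟏 ⊗ X) X :=
  lunit (rd_monoidal D) X.
Definition mul1r {D : ring_data} (X : D) : hom (X ⊗ 𝟏) X :=
  runit (rd_monoidal D) X.
Definition Ld {D : ring_data} (A X Y : D)
  : hom (A ⊗ (X ⊕ Y)) ((A ⊗ X) ⊕ (A ⊗ Y)) := ldist (rd_ldist D) A X Y.
Definition Rd {D : ring_data} (X Y A : D)
  : hom ((X ⊕ Y) ⊗ A) ((X ⊗ A) ⊕ (Y ⊗ A)) := rdist (rd_rdist D) X Y A.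

Record common_axioms (D : ring_data) : Prop := CommonAxioms {
  ca_Ld_mulA : forall A B X Y : D,
    Ld (A ⊗ B) X Y ∘ mulA A B (X ⊕ Y)
    = (mulA A B X ⊕ mulA A B Y) ∘ Ld A (B ⊗ X) (B ⊗ Y) ∘ (idm A ⊗ Ld B X Y);
  ca_Rd_mulA : forall X Y B A : D,
    Rd (X ⊗ B) (Y ⊗ B) A ∘ (Rd X Y B ⊗ idm A) ∘ mulA (X ⊕ Y) B A
    = (mulA X B A ⊕ mulA Y B A) ∘ Rd X Y (B ⊗ A);
  ca_Ld_Rd_mulA : forall A X Y B : D,
    Rd (A ⊗ X) (A ⊗ Y) B ∘ (Ld A X Y ⊗ idm B) ∘ mulA A (X ⊕ Y) B
    = (mulA A X B ⊕ mulA A Y B) ∘ Ld A (X ⊗ B) (Y ⊗ B) ∘ (idm A ⊗ Rd X Y B);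
  ca_exch : forall A B X Y : D,
    exch (A ⊗ X) (B ⊗ X) (A ⊗ Y) (B ⊗ Y) ∘ (Rd A B X ⊕ Rd A B Y)
      ∘ Ld (A ⊕ B) X Y
    = (Ld A X Y ⊕ Ld B X Y) ∘ Rd A B (X ⊕ Y);
  ca_Ld_one : forall X Y : D,
    (mul1l X ⊕ mul1l Y) ∘ Ld 𝟏 X Y = mul1l (X ⊕ Y);
  ca_Rd_one : forall X Y : D,
    (mul1r X ⊕ mul1r Y) ∘ Rd X Y 𝟏 = mul1r (X ⊕ Y)
}.

Record is_ann_category (D : ring_data) : Prop := IsAnnCategory {
  ann_common : common_axioms D;
  ann_Ld_addA : forall A X Y Z : D,
    addA (A ⊗ X) (A ⊗ Y) (A ⊗ Z) ∘ (idm (A ⊗ X) ⊕ Ld A Y Z) ∘ Ld A X (Y ⊕ Z)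
    = (Ld A X Y ⊕ idm (A ⊗ Z)) ∘ Ld A (X ⊕ Y) Z ∘ (idm A ⊗ addA X Y Z);
  ann_Ld_addC : forall A X Y : D,
    addC (A ⊗ X) (A ⊗ Y) ∘ Ld A X Y = Ld A Y X ∘ (idm A ⊗ addC X Y);
  ann_Rd_addA : forall X Y Z A : D,
    addA (X ⊗ A) (Y ⊗ A) (Z ⊗ A) ∘ (idm (X ⊗ A) ⊕ Rd Y Z A) ∘ Rd X (Y ⊕ Z) A
    = (Rd X Y A ⊕ idm (Z ⊗ A)) ∘ Rd (X ⊕ Y) Z A ∘ (addA X Y Z ⊗ idm A);
  ann_Rd_addC : forall X Y A : D,
    addC (X ⊗ A) (Y ⊗ A) ∘ Rd X Y A = Rd Y X A ∘ (addC X Y ⊗ idm A)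
}.

Record is_categorical_ring (D : ring_data) : Prop := IsCategoricalRing {
  cr_common : common_axioms D;
  cr_Ld_exch : forall R X Y Z T : D,
    exch (R ⊗ X) (R ⊗ Y) (R ⊗ Z) (R ⊗ T) ∘ (Ld R X Y ⊕ Ld R Z T)
      ∘ Ld R (X ⊕ Y) (Z ⊕ T)
    = (Ld R X Z ⊕ Ld R Y T) ∘ Ld R (X ⊕ Z) (Y ⊕ T) ∘ (idm R ⊗ exch X Y Z T);
  cr_Rd_exch : forall X Y Z T S : D,
    exch (X ⊗ S) (Y ⊗ S) (Z ⊗ S) (T ⊗ S) ∘ (Rd X Y S ⊕ Rd Z T S)
      ∘ Rd (X ⊕ Y) (Z ⊕ T) S
    = (Rd X Z S ⊕ Rd Y T S) ∘ Rd (X ⊕ Z) (Y ⊕ T) S ∘ (exch X Y Z T ⊗ idm S)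
}.

(** No naturality in A is required of the two isomorphisms. *)
Definition condition_U (D : ring_data) : Prop :=
  forall A : D, exists (hL : hom (A ⊗ 𝟎) 𝟎) (hR : hom (𝟎 ⊗ A) 𝟎),
  forall X : D,
    add0l (A ⊗ X) ∘ (hL ⊕ idm (A ⊗ X)) ∘ Ld A 𝟎 X = idm A ⊗ add0l X /\
    add0r (A ⊗ X) ∘ (idm (A ⊗ X) ⊕ hL) ∘ Ld A X 𝟎 = idm A ⊗ add0r X /\
    add0l (X ⊗ A) ∘ (hR ⊕ idm (X ⊗ A)) ∘ Rd 𝟎 X A = add0l X ⊗ idm A /\
    add0r (X ⊗ A) ∘ (idm (X ⊗ A) ⊕ hR) ∘ Rd X 𝟎 A = add0r X ⊗ idm A.

(* Main.v *)
Require Import Defs.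
From Corelib Require Import ssreflect.

(** Fix an object [A].  Tensoring with [A], on either side, is an endofunctor
    [F] equipped with a natural comparison [F (X ⊕ Y) -> F X ⊕ F Y]; the axioms
    of a categorical ring say that this comparison respects the exchange
    [exch], and condition (U) that it respects the zero object and its two unit
    isomorphisms.  An Ann-category asks instead that it respect [addA] and
    [addC].

    The point is that [addA] and [addC] are instances of [exch] with zeros
    inserted:
    - [exch X 𝟎 Y Z : (X ⊕ 𝟎) ⊕ (Y ⊕ Z) -> (X ⊕ Y) ⊕ (𝟎 ⊕ Z)] becomes
      [addA X Y Z] once both zeros are cancelled ([exch_zero_inner]);
    - [exch 𝟎 X Y 𝟎 : (𝟎 ⊕ X) ⊕ (Y ⊕ 𝟎) -> (𝟎 ⊕ Y) ⊕ (X ⊕ 𝟎)] becomes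
      [addC X Y] once both zeros are cancelled ([exch_zero_outer]).

    Cancelling zeros inside [F] and after applying the comparison agree, by
    (U).  Hence the compatibility of [F] with [exch] descends to compatibility
    with [addA] and [addC]; [preserves_contracted_exch] is this descent, done
    once for both.  The identification of [exch] with zeros rests on the
    classical lemma of Kelly that the two unit triangles with the unit in an
    outer position follow from the pentagon and the middle triangle
    ([lunit_sum], [runit_sum]). *)

(** * Calculus in a groupoid *)

Lemma comp_cancel_l {A : groupoid} {X Y Z : A} (h : hom Y Z) {f f' : hom X Y} :
  h ∘ f = h ∘ f' -> f = f'.
Proof.
move=> /(f_equal (comp (inv h))).
by rewrite !comp_assoc comp_invl !comp_idl.
Qed.

Lemma comp_cancel_r {A : groupoid} {X Y Z : A} (h : hom X Y) {f f' : hom Y Z} :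
  f ∘ h = f' ∘ h -> f = f'.
Proof.
move=> /(f_equal (fun k => k ∘ inv h)).
by rewrite -!comp_assoc comp_invr !comp_idr.
Qed.

(** This and the next lemma let an equation between composites be used for
    rewriting inside a longer composite associated to the left. *)
Lemma under2 {A : groupoid} {X Y Z W : A} {g : hom Y Z} {f : hom X Y}
    (r : hom X Z) {h : hom Z W} :
  g ∘ f = r -> h ∘ g ∘ f = h ∘ r.
Proof. by move=> <-; rewrite comp_assoc. Qed.

Lemma under3 {A : groupoid} {X Y Z T W : A} {k : hom Z T} {g : hom Y Z}
    {f : hom X Y} {r : hom X T} {h : hom T W} :
  k ∘ g ∘ f = r -> h ∘ k ∘ g ∘ f = h ∘ r.
Proof. by move=> <-; rewrite !comp_assoc. Qed.

Lemma paste_squares {A : groupoid} {X X' Y Y' Z Z' : A}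
    {f : hom X X'} (g : hom Y Y') {h : hom Z Z'}
    {p : hom X Y} {p' : hom X' Y'} {q : hom Y Z} {q' : hom Y' Z'} :
  q' ∘ g = h ∘ q -> p' ∘ f = g ∘ p -> q' ∘ p' ∘ f = h ∘ (q ∘ p).
Proof.
by move=> Eq Ep; rewrite -comp_assoc Ep !comp_assoc Eq.
Qed.

Lemma inv_square {A : groupoid} {X X' Y Y' : A}
    {f : hom X X'} {g : hom Y Y'} {p : hom X Y} {p' : hom X' Y'} :
  p' ∘ f = g ∘ p -> inv p' ∘ g = f ∘ inv p.
Proof.
move=> E; apply: (comp_cancel_l p'); apply: (comp_cancel_r p).
by rewrite !comp_assoc comp_invr comp_idl E -!comp_assoc comp_invl comp_idr.
Qed.

(** * Unit triangles of Kelly *)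

(** [lunit] is a natural isomorphism from tensoring with the unit to the
    identity functor. *)
Lemma unit_faithful_l {A : groupoid} {F : bifunctor A} {I : A}
    (M : monoidal F I) {X Y : A} {f f' : hom X Y} :
  bi_mor F (idm I) f = bi_mor F (idm I) f' -> f = f'.
Proof.
move=> E; apply: (comp_cancel_r (lunit M X)).
by rewrite -!lunit_nat E.
Qed.

Lemma unit_faithful_r {A : groupoid} {F : bifunctor A} {I : A}
    (M : monoidal F I) {X Y : A} {f f' : hom X Y} :
  bi_mor F f (idm I) = bi_mor F f' (idm I) -> f = f'.
Proof.
move=> E; apply: (comp_cancel_r (runit M X)).
by rewrite -!runit_nat E.
Qed.

(** After tensoring with [I] on the left, both sides appear as edges of the
    pentagon on [I, I, X, Y] followed by the middle triangle. *)
Lemma lunit_sum {A : groupoid} {F : bifunctor A} {I : A} (M : monoidal F I)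
    (X Y : A) :
  bi_mor F (lunit M X) (idm Y) ∘ assoc M I X Y = lunit M (F X Y).
Proof.
apply: (unit_faithful_l M).
apply: (comp_cancel_l (assoc M I X Y)).
have P := f_equal
  (comp (bi_mor F (bi_mor F (runit M I) (idm X)) (idm Y))) (pentagon _ _ M I I X Y).
move: P; rewrite !comp_assoc -assoc_nat bi_mor_id -comp_assoc triangle => ->.
rewrite -bi_mor_comp triangle comp_idl -assoc_nat -comp_assoc -bi_mor_comp.
by rewrite comp_idl.
Qed.

(** As before, after tensoring with [I] on the right and with the pentagon on [X, Y, I, I]. *)
Lemma runit_sum {A : groupoid} {F : bifunctor A} {I : A} (M : monoidal F I)
    (X Y : A) :
  runit M (F X Y) ∘ assoc M X Y I = bi_mor F (idm X) (runit M Y).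
Proof.
apply: (unit_faithful_r M).
apply: (comp_cancel_r
  (assoc M X (F Y I) I ∘ bi_mor F (idm X) (assoc M Y I I))).
have P := f_equal
  (comp (bi_mor F (runit M (F X Y)) (idm I))) (pentagon _ _ M X Y I I).
move: P; rewrite !comp_assoc -bi_mor_comp comp_idl => <-.
rewrite triangle -bi_mor_id -assoc_nat -assoc_nat -comp_assoc -bi_mor_comp.
by rewrite triangle comp_idl.
Qed.

(** * The exchange isomorphism and zeros *)

Lemma sum_square (A : groupoid) (F : bifunctor A) (X X' Y Y' U U' V V' : A)
    (f : hom X X') (g : hom Y Y') (p : hom X Y) (p' : hom X' Y')
    (h : hom U U') (k : hom V V') (q : hom U V) (q' : hom U' V') :
  p' ∘ f = g ∘ p -> q' ∘ h = k ∘ q ->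
  bi_mor F p' q' ∘ bi_mor F f h = bi_mor F g k ∘ bi_mor F p q.
Proof. by move=> Ep Eq; rewrite -!bi_mor_comp Ep Eq. Qed.

Lemma id_square (A : groupoid) (X Y : A) (f : hom X Y) :
  idm Y ∘ f = f ∘ idm X.
Proof. by rewrite comp_idl comp_idr. Qed.

Lemma exch_nat (G : sym_cat_group) (U U' V V' Z Z' T T' : G)
    (f : hom U U') (g : hom V V') (h : hom Z Z') (k : hom T T') :
  exch U' V' Z' T' ∘ ((f ⊕ g) ⊕ (h ⊕ k)) = ((f ⊕ h) ⊕ (g ⊕ k)) ∘ exch U V Z T.
Proof.
have Ea X X' Y Y' W W' (a : hom X X') (b : hom Y Y') (c : hom W W') :=
  assoc_nat _ _ (scg_monoidal G) X X' Y Y' W W' a b c.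
rewrite /exch /addA /addC.
apply: (paste_squares (f ⊕ (g ⊕ (h ⊕ k)))); last first.
  exact/inv_square/Ea.
apply: (paste_squares (f ⊕ ((g ⊕ h) ⊕ k))); last first.
  by apply: sum_square; [exact: id_square | exact: Ea].
apply: (paste_squares (f ⊕ ((h ⊕ g) ⊕ k))); last first.
  apply: sum_square; first exact: id_square.
  by apply: sum_square; [exact: braid_nat | exact: id_square].
apply: (paste_squares (f ⊕ (h ⊕ (g ⊕ k)))); last first.
  by apply: sum_square; [exact: id_square | exact/inv_square/Ea].
exact: Ea.
Qed.

Lemma add0r_addC (G : sym_cat_group) (X : G) : add0r X ∘ addC 𝟎 X = add0l X.
Proof.
by rewrite /add0r /addC -(braid_unit _ (scg_symmetry G)) -comp_assoc braid_sym
  comp_idr.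
Qed.

Lemma triangle_inv (G : sym_cat_group) (X Y : G) :
  (idm X ⊕ add0l Y) ∘ inv (addA X 𝟎 Y) = add0r X ⊕ idm Y.
Proof.
by rewrite /add0l -triangle -comp_assoc comp_invr comp_idr.
Qed.

(** The two cancelled objects are allowed to be merely isomorphic to [𝟎],
    through [u], because an additive functor need not send [𝟎] to [𝟎]. *)
Lemma exch_zero_inner {G : sym_cat_group} (X : G) {U : G} (Y Z : G)
    (u : hom U 𝟎) :
  (idm (X ⊕ Y) ⊕ (add0l Z ∘ (u ⊕ idm Z))) ∘ exch X U Y Z
  = addA X Y Z ∘ ((add0r X ∘ (idm X ⊕ u)) ⊕ idm (Y ⊕ Z)).
Proof.
have -> : idm (X ⊕ Y) ⊕ (add0l Z ∘ (u ⊕ idm Z))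
    = (idm (X ⊕ Y) ⊕ add0l Z) ∘ ((idm X ⊕ idm Y) ⊕ (u ⊕ idm Z)).
  by rewrite -bi_mor_comp bi_mor_id comp_idl.
have -> : (add0r X ∘ (idm X ⊕ u)) ⊕ idm (Y ⊕ Z)
    = (add0r X ⊕ idm (Y ⊕ Z)) ∘ ((idm X ⊕ u) ⊕ (idm Y ⊕ idm Z)).
  by rewrite -bi_mor_comp bi_mor_id comp_idl.
rewrite -comp_assoc -exch_nat /exch !comp_assoc; congr (_ ∘ _).
(* Reading [exch] from its last factor to its first, the zero is cancelled
   against Z, Y on its left, Y on its right, [Y ⊕ Z], and finally X. *)
rewrite -(bi_mor_id _ (scg_sum G) X Y) /addA -assoc_nat -/addA.
rewrite (under2 (idm X ⊕ (add0r Y ⊕ idm Z))).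
  by rewrite -bi_mor_comp comp_idl triangle_inv.
rewrite (under2 (idm X ⊕ (add0l Y ⊕ idm Z))).
  by rewrite -!bi_mor_comp !comp_idl add0r_addC.
rewrite (under2 (idm X ⊕ add0l (Y ⊕ Z))).
  by rewrite -bi_mor_comp comp_idl /add0l lunit_sum.
by rewrite -comp_assoc triangle_inv.
Qed.

Lemma exch_zero_outer {G : sym_cat_group} {U V : G} (X Y : G)
    (u : hom U 𝟎) (v : hom V 𝟎) :
  ((add0l Y ∘ (u ⊕ idm Y)) ⊕ (add0r X ∘ (idm X ⊕ v))) ∘ exch U X Y V
  = addC X Y ∘ ((add0l X ∘ (u ⊕ idm X)) ⊕ (add0r Y ∘ (idm Y ⊕ v))).
Proof.
rewrite !bi_mor_comp -comp_assoc -exch_nat /exch !comp_assoc; congr (_ ∘ _).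
have -> : add0l Y ⊕ add0r X
    = (add0l Y ⊕ idm X) ∘ ((idm 𝟎 ⊕ idm Y) ⊕ add0r X).
  by rewrite -bi_mor_comp bi_mor_id comp_idl comp_idr.
(* Reading [exch] from its last factor to its first, the right zero is
   cancelled against X, [Y ⊕ X], [X ⊕ Y] and finally Y. *)
rewrite (under2 (addA 𝟎 Y X ∘ (idm 𝟎 ⊕ (idm Y ⊕ add0r X))));
  first by rewrite /addA assoc_nat.
rewrite !comp_assoc [(_ ⊕ idm X) ∘ addA _ _ _]lunit_sum.
rewrite (under2 (idm 𝟎 ⊕ add0r (Y ⊕ X))).
  rewrite -bi_mor_comp comp_idl /add0r -runit_sum -comp_assoc comp_invr.
  by rewrite comp_idr.
rewrite (under2 (idm 𝟎 ⊕ (addC X Y ∘ add0r (X ⊕ Y)))).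
  by rewrite -bi_mor_comp comp_idl /add0r runit_nat.
rewrite (under2 (idm 𝟎 ⊕ (addC X Y ∘ (idm X ⊕ add0r Y)))).
  by rewrite -bi_mor_comp comp_idl -comp_assoc /add0r runit_sum.
(* The zero at the left end goes last, so [addC] can come out in front. *)
rewrite lunit_nat -!comp_assoc; congr (_ ∘ _).
rewrite -lunit_sum -comp_assoc comp_invr comp_idr -bi_mor_comp.
by rewrite comp_idl comp_idr.
Qed.

(** * Functors comparing sums *)

Record sum_functor (G : sym_cat_group) : Type := SumFunctor {
  sf_obj :> G -> G;
  sf_mor : forall X Y, hom X Y -> hom (sf_obj X) (sf_obj Y);
  sf_id : forall X, sf_mor X X (idm X) = idm (sf_obj X);
  sf_comp : forall X Y Z (g : hom Y Z) (f : hom X Y),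
    sf_mor _ _ (g ∘ f) = sf_mor _ _ g ∘ sf_mor _ _ f;
  sf_sum : forall X Y, hom (sf_obj (X ⊕ Y)) (sf_obj X ⊕ sf_obj Y);
  sf_sum_nat : forall X X' Y Y' (f : hom X X') (g : hom Y Y'),
    sf_sum X' Y' ∘ sf_mor _ _ (f ⊕ g)
    = (sf_mor _ _ f ⊕ sf_mor _ _ g) ∘ sf_sum X Y
}.
Arguments sf_mor {G} F {X Y} f%_cmor : rename.
Arguments sf_sum {G} F X%_cobj Y%_cobj : rename.

Definition preserves_exch {G : sym_cat_group} (F : sum_functor G) : Prop :=
  forall X Y Z T : G,
  exch (F X) (F Y) (F Z) (F T) ∘ (sf_sum F X Y ⊕ sf_sum F Z T)
    ∘ sf_sum F (X ⊕ Y) (Z ⊕ T)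
  = (sf_sum F X Z ⊕ sf_sum F Y T) ∘ sf_sum F (X ⊕ Z) (Y ⊕ T)
    ∘ sf_mor F (exch X Y Z T).

Definition preserves_zero {G : sym_cat_group} (F : sum_functor G)
    (u : hom (F 𝟎%cobj) 𝟎) : Prop :=
  forall X : G,
  add0l (F X) ∘ (u ⊕ idm (F X)) ∘ sf_sum F 𝟎 X = sf_mor F (add0l X) /\
  add0r (F X) ∘ (idm (F X) ⊕ u) ∘ sf_sum F X 𝟎 = sf_mor F (add0r X).

Lemma sf_sum_contract {G : sym_cat_group} {F : sum_functor G}
    {X Y Z T W W' V V' : G}
    {p : hom (X ⊕ Y) W} {q : hom (Z ⊕ T) W'}
    {P : hom (F X ⊕ F Y) V} {Q : hom (F Z ⊕ F T) V'}
    {α : hom (F W) V} {β : hom (F W') V'} :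
  α ∘ sf_mor F p = P ∘ sf_sum F X Y -> β ∘ sf_mor F q = Q ∘ sf_sum F Z T ->
  (α ⊕ β) ∘ sf_sum F W W' ∘ sf_mor F (p ⊕ q)
  = (P ⊕ Q) ∘ (sf_sum F X Y ⊕ sf_sum F Z T) ∘ sf_sum F (X ⊕ Y) (Z ⊕ T).
Proof.
move=> Ep Eq.
by rewrite -comp_assoc sf_sum_nat comp_assoc -!bi_mor_comp Ep Eq.
Qed.

(** Suppose that [κ] is what remains of [exch] after contracting the four
    summands along [p, q] at the source and [p', q'] at the target, and that
    [κ'] is obtained likewise along [P, Q] and [P', Q'] from the exchange of
    the images under [F].  If the comparison of [F] carries the first
    contractions to the second, it carries [κ] to [κ']: all morphisms being
    invertible, this may be checked after precomposition with [F (p ⊕ q)],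
    where it is the compatibility of [F] with [exch]. *)
Lemma preserves_contracted_exch {G : sym_cat_group} {F : sum_functor G}
    {X Y Z T W1 W2 W1' W2' V1 V2 V1' V2' : G}
    (p : hom (X ⊕ Y) W1) (q : hom (Z ⊕ T) W2)
    (p' : hom (X ⊕ Z) W1') (q' : hom (Y ⊕ T) W2')
    (P : hom (F X ⊕ F Y) V1) (Q : hom (F Z ⊕ F T) V2)
    (P' : hom (F X ⊕ F Z) V1') (Q' : hom (F Y ⊕ F T) V2')
    (α : hom (F W1) V1) (β : hom (F W2) V2)
    (α' : hom (F W1') V1') (β' : hom (F W2') V2')
    (κ : hom (W1 ⊕ W2) (W1' ⊕ W2')) (κ' : hom (V1 ⊕ V2) (V1' ⊕ V2')) :
  preserves_exch F ->
  α ∘ sf_mor F p = P ∘ sf_sum F X Y -> β ∘ sf_mor F q = Q ∘ sf_sum F Z T ->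
  α' ∘ sf_mor F p' = P' ∘ sf_sum F X Z -> β' ∘ sf_mor F q' = Q' ∘ sf_sum F Y T ->
  (p' ⊕ q') ∘ exch X Y Z T = κ ∘ (p ⊕ q) ->
  (P' ⊕ Q') ∘ exch (F X) (F Y) (F Z) (F T) = κ' ∘ (P ⊕ Q) ->
  κ' ∘ (α ⊕ β) ∘ sf_sum F W1 W2 = (α' ⊕ β') ∘ sf_sum F W1' W2' ∘ sf_mor F κ.
Proof.
move=> Fexch Ep Eq Ep' Eq' Eκ Eκ'.
apply: (comp_cancel_r (sf_mor F (p ⊕ q))).
rewrite (under3 (sf_sum_contract Ep Eq)).
rewrite 2!comp_assoc -Eκ' -[RHS]comp_assoc -sf_comp -Eκ sf_comp [RHS]comp_assoc.
rewrite (sf_sum_contract Ep' Eq').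
by rewrite (under3 (Fexch X Y Z T)) 2!comp_assoc.
Qed.

Lemma sf_sum_addA {G : sym_cat_group} (F : sum_functor G) (u : hom (F 𝟎%cobj) 𝟎) :
  preserves_exch F -> preserves_zero F u -> forall X Y Z : G,
  addA (F X) (F Y) (F Z) ∘ (idm (F X) ⊕ sf_sum F Y Z) ∘ sf_sum F X (Y ⊕ Z)
  = (sf_sum F X Y ⊕ idm (F Z)) ∘ sf_sum F (X ⊕ Y) Z ∘ sf_mor F (addA X Y Z).
Proof.
move=> Fexch Fzero X Y Z.
apply: (preserves_contracted_exch
  (add0r X) (idm (Y ⊕ Z)) (idm (X ⊕ Y)) (add0l Z)
  (add0r (F X) ∘ (idm (F X) ⊕ u)) (idm _) (idm _) (add0l (F Z) ∘ (u ⊕ idm (F Z))))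
  => //.
- by rewrite comp_idl (proj2 (Fzero X)).
- by rewrite sf_id id_square.
- by rewrite sf_id id_square.
- by rewrite comp_idl (proj1 (Fzero Z)).
- have := exch_zero_inner X Y Z (idm 𝟎).
  by rewrite !bi_mor_id !comp_idr.
- exact: exch_zero_inner.
Qed.

Lemma sf_sum_addC {G : sym_cat_group} (F : sum_functor G) (u : hom (F 𝟎%cobj) 𝟎) :
  preserves_exch F -> preserves_zero F u -> forall X Y : G,
  addC (F X) (F Y) ∘ sf_sum F X Y = sf_sum F Y X ∘ sf_mor F (addC X Y).
Proof.
move=> Fexch Fzero X Y.
have := preserves_contracted_exch (F := F)
  (add0l X) (add0r Y) (add0l Y) (add0r X)
  (add0l (F X) ∘ (u ⊕ idm (F X))) (add0r (F Y) ∘ (idm (F Y) ⊕ u))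
  (add0l (F Y) ∘ (u ⊕ idm (F Y))) (add0r (F X) ∘ (idm (F X) ⊕ u))
  (idm _) (idm _) (idm _) (idm _) (addC X Y) (addC (F X) (F Y)).
rewrite !bi_mor_id !comp_idr !comp_idl; apply => //.
- by rewrite (proj1 (Fzero X)).
- by rewrite (proj2 (Fzero Y)).
- by rewrite (proj1 (Fzero Y)).
- by rewrite (proj2 (Fzero X)).
- have := exch_zero_outer X Y (idm 𝟎) (idm 𝟎).
  by rewrite !bi_mor_id !comp_idr.
- exact: exch_zero_outer.
Qed.

(** * Multiplication by an object *)

Lemma bi_mor_comp_idl (A : groupoid) (F : bifunctor A) (B X Y Z : A)
    (g : hom Y Z) (f : hom X Y) :
  bi_mor F (idm B) (g ∘ f) = bi_mor F (idm B) g ∘ bi_mor F (idm B) f.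
Proof. by rewrite -bi_mor_comp comp_idl. Qed.

Lemma bi_mor_comp_idr (A : groupoid) (F : bifunctor A) (B X Y Z : A)
    (g : hom Y Z) (f : hom X Y) :
  bi_mor F (g ∘ f) (idm B) = bi_mor F g (idm B) ∘ bi_mor F f (idm B).
Proof. by rewrite -bi_mor_comp comp_idl. Qed.

Definition left_mul (D : ring_data) (A : D) : sum_functor D :=
  SumFunctor D (fun X => A ⊗ X)%cobj (fun X Y f => idm A ⊗ f)
    (bi_mor_id _ _ A) (bi_mor_comp_idl _ _ A) (Ld A)
    (fun X X' Y Y' => ldist_nat _ _ (rd_ldist D) A A X X' Y Y' (idm A)).

Definition right_mul (D : ring_data) (A : D) : sum_functor D :=
  SumFunctor D (fun X => X ⊗ A)%cobj (fun X Y f => f ⊗ idm A)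
    (fun X => bi_mor_id _ _ X A) (bi_mor_comp_idr _ _ A) (fun X Y => Rd X Y A)
    (fun X X' Y Y' f g => rdist_nat _ _ (rd_rdist D) X X' Y Y' A A f g (idm A)).

Theorem theorem4 (D : ring_data) :
  is_categorical_ring D -> condition_U D -> is_ann_category D.
Proof.
move=> [Dcommon DL DR] DU; split => // [A X Y Z|A X Y|X Y Z A|X Y A];
  have [hL [hR Dzero]] := DU A.
- apply: (sf_sum_addA (left_mul D A) hL); first exact: DL.
  by move=> T; have [? [? _]] := Dzero T.
- apply: (sf_sum_addC (left_mul D A) hL); first exact: DL.
  by move=> T; have [? [? _]] := Dzero T.
- apply: (sf_sum_addA (right_mul D A) hR).
    by move=> U V W T; exact: DR.
  by move=> T; have [_ [_ []]] := Dzero T.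
- apply: (sf_sum_addC (right_mul D A) hR).
    by move=> U V W T; exact: DR.
  by move=> T; have [_ [_ []]] := Dzero T.
Qed.
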